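(* Let $t>1$ be fixed and let $K\subset\mathbb{C}$ be a compact set with $\operatorname{cap}(K)=t$. Then $$\limsup_{n\to\infty}\frac{\log A_n(K)}{n}\leq -2\log t .$$ In particular, $\vartheta(K)=0$.
   Context: For a complex polynomial $p$, its unit lemniscate is $\Lambda_p=\{z\in\mathbb{C}:|p(z)|<1\}$. For a compact set $K\subset\mathbb{C}$ and $n\in\mathbb{N}$ (with $n\ge 1$), $\mathscr{P}_n(K)$ denotes the set of monic polynomials of degree $n$ all of whose zeros lie in $K$, i.e. $p(z)=\prod_{j=1}^n(z-z_j)$ with $z_j\in K$ (repetitions allowed). Let $m$ be Lebesgue (area) measure on $\mathbb{C}$, and define $A_n(K)=\inf_{p\in\mathscr{P}_n(K)}m(\Lambda_p)$ and $\vartheta(K)=\inf_{n}A_n(K)$. The logarithmic capacity $\operatorname{cap}(K)$ is defined by $\log\operatorname{cap}(K)=\sup_{\mu\in\mathcal{P}(K)}\int_K U_\mu(z)\,d\mu(z)$, where $\mathcal{P}(K)$ is the set of Borel probability measures on $K$ and $U_\mu(z)=\int_K\log|z-w|\,d\mu(w)$ (with $\operatorname{cap}(K)=0$ if the supremum is $-\infty$). *)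

(* Defs.v *)
From mathcomp Require Import all_boot all_order all_algebra.
From mathcomp Require Import complex.
From mathcomp Require Import all_classical all_reals all_analysis.

Set Implicit Arguments.
Unset Strict Implicit.
Unset Printing Implicit Defensive.

Import Order.TTheory GRing.Theory Num.Theory.
Import numFieldNormedType.Exports.

Local Open Scope classical_set_scope.
Local Open Scope complex_scope.
Local Open Scope ring_scope.

(* Subsets of the complex plane are subsets of R * R, whose product topology
   and product sigma-algebra are the usual topology and Borel sigma-algebra;
   toC is the identification with R[i], over which polynomials are taken. *)
Definition toC {R : realType} (z : R * R) : R[i] := z.1 +i* z.2.

Definition area {R : realType} : set (R * R) -> \bar R :=
  (lebesgue_measure \x lebesgue_measure)%E.

Definition lemniscate {R : realType} (p : {poly R[i]}) : set (R * R) :=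
  [set z | Normc.normc p.[toC z] < 1].

Definition monic_zeros_in {R : realType} (n : nat) (K : set (R * R)) :
    set {poly R[i]} :=
  [set p | exists zs : n.-tuple (R * R),
     (forall j : 'I_n, K (tnth zs j)) /\
     p = \prod_(j < n) ('X - (toC (tnth zs j))%:P)].

Definition min_area {R : realType} (n : nat) (K : set (R * R)) : \bar R :=
  ereal_inf [set area (lemniscate p) | p in monic_zeros_in n K].

Definition inf_min_area {R : realType} (K : set (R * R)) : \bar R :=
  ereal_inf [set min_area n K | n in [set n | (0 < n)%N]].

(* A Borel probability measure on K is one on the plane giving K mass 1. *)
Definition probabilities_on {R : realType} (K : set (R * R)) :
    set (probability (R * R)%type R) :=
  [set mu | mu K = 1%E].

(* lne 0 = -oo, so the kernel is -oo on the diagonal. *)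
Definition log_potential {R : realType} (K : set (R * R))
    (mu : probability (R * R)%type R) (z : R * R) : \bar R :=
  (\int[mu]_(w in K) lne (Normc.normc (toC z - toC w))%:E)%E.

Definition log_energy {R : realType} (K : set (R * R))
    (mu : probability (R * R)%type R) : \bar R :=
  (\int[mu]_(z in K) log_potential K mu z)%E.

(* expeR -oo = 0 *)
Definition capacity {R : realType} (K : set (R * R)) : \bar R :=
  expeR (ereal_sup [set log_energy K mu | mu in probabilities_on K]).

(* Main.v *)
Require Import Defs.
From mathcomp Require Import all_boot all_order all_algebra.
From mathcomp Require Import complex.
From mathcomp Require Import all_classical all_reals all_analysis.
From mathcomp Require Import measurable_realfun ring lra.
Set Implicit Arguments.
Unset Strict Implicit.
Unset Printing Implicit Defensive.
Import Order.TTheory GRing.Theory Num.Theory.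
Import numFieldNormedType.Exports.
Local Open Scope classical_set_scope.
Local Open Scope ring_scope.

(** The polynomials that witness the bound have nearly extremal Fekete points
    of K as zeros.  Write V(s) for the product of the distances between the
    pairs of points of a finite list s, and let p have the n distinct zeros
    z_1, ..., z_n in K.

    Lagrange interpolation of the constant 1 at the zeros reads
    1 / p(z) = sum_j 1 / (p'(z_j) (z - z_j)).  Where |p(z)| < 1, one of the n
    terms on the right has modulus at least 1 / (n |p(z)|), so that z lies
    within n / |p'(z_j)| of z_j ([lemniscate_cover]).  The lemniscate is thus
    covered by n small discs, and if all |p'(z_j)| are at least t^(n-1) / 2 its
    area is O(n^3 t^(-2n)) ([area_lemniscate_le]).

    To make all the |p'(z_j)| large, choose the z_j in K so that V is at least
    half of its supremum over n-point lists in K.  Replacing z_j by any other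
    point of K at most doubles V, so the monic polynomial q = p / (X - z_j), of
    degree n-1, satisfies |q| <= 2 |q(z_j)| = 2 |p'(z_j)| on K
    ([near_fekete]).  It remains to see that a monic polynomial of degree d
    cannot be smaller than t^d everywhere on K ([chebyshev_lower_bound]).

    This last fact compares two estimates of the largest V among N-point lists.
    Integrating the energy of such a list with respect to a measure mu, one
    point at a time and keeping each time a point that does no worse than the
    average, yields a list with log V >= binomial(N, 2) I(mu), where I(mu) is
    the logarithmic energy ([greedy_points], [capacity_transfinite]); by the
    definition of capacity, V can be as large as about t^(N^2 / 2).  In the
    other direction, interpolating a monic polynomial of degree n-1 at n points
    and comparing leading coefficients gives 1 = sum_j Q(z_j) / p'(z_j), so some
    |p'(z_j)| is at most n sup|Q|; removing that point and iterating bounds V by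
    N! times a product of suprema of arbitrary monic polynomials of degrees
    0, ..., N-1 ([vandermonde_le]).  If a monic q of degree d satisfies
    |q| <= M on K, the polynomials q^(k / d) X^(k mod d) make this product about
    M^(N^2 / (2d)), and letting N grow yields M >= t^d. *)

(** * The modulus of a complex number *)

Local Notation normc := Normc.normc.

Section Modulus.
Variable R : realType.
Implicit Types x y : R[i].

Lemma norm_normc x : `|x| = (normc x)%:C%C.
Proof. by case: x => a b; rewrite normc_def. Qed.

Lemma normc_ge0 x : 0 <= normc x.
Proof. by case: x => a b; exact: sqrtr_ge0. Qed.

Lemma normc_eq0 x : (normc x == 0) = (x == 0).
Proof.
by apply/eqP/eqP => [/Normc.eq0_normc//|->]; exact: Normc.normc0.
Qed.

Lemma normcBC x y : normc (x - y) = normc (y - x).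
Proof. by rewrite -(opprB y) normcN. Qed.

Lemma ler_normcD x y : normc (x + y) <= normc x + normc y.
Proof. by rewrite -lecR rmorphD/= -!norm_normc ler_normD. Qed.

Lemma ler_normc_sum (I : Type) (r : seq I) (F : I -> R[i]) :
  normc (\sum_(i <- r) F i) <= \sum_(i <- r) normc (F i).
Proof.
elim/big_ind2 : _ => [|x1 x2 y1 y2 h1 h2|//]; first by rewrite Normc.normc0.
by rewrite (le_trans (ler_normcD _ _))// lerD.
Qed.

Lemma normc_prod (I : Type) (r : seq I) (F : I -> R[i]) :
  normc (\prod_(i <- r) F i) = \prod_(i <- r) normc (F i).
Proof.
elim/big_ind2 : _ => [|x1 x2 y1 y2 <- <-|//]; first exact: Normc.normc1.
exact: Normc.normcM.
Qed.

Lemma normcX x n : normc (x ^+ n) = normc x ^+ n.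
Proof.
by elim: n => [|n IH]; rewrite ?expr0 ?Normc.normc1// !exprS Normc.normcM IH.
Qed.

Lemma normc_sum1_pigeonhole (I : eqType) (s : seq I) (F : I -> R[i]) :
  \sum_(i <- s) F i = 1 ->
  exists2 i, i \in s & 1 <= (size s)%:R * normc (F i).
Proof.
move=> sF1; apply: contrapT => H.
have {}H i : i \in s -> (size s)%:R * normc (F i) < 1.
  by move=> si; rewrite ltNge; apply/negP => h; apply: H; exists i.
case: s sF1 H => [|i0 s] sF1 H.
  by move/eqP: sF1; rewrite big_nil eq_sym oner_eq0.
have n0 : 0 < (size (i0 :: s))%:R :> R by rewrite ltr0n.
suff : normc (\sum_(i <- i0 :: s) F i) < 1 by rewrite sF1 Normc.normc1 ltxx.
apply: (le_lt_trans (ler_normc_sum _ _)).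
have -> : 1 = \sum_(i <- i0 :: s) ((size (i0 :: s))%:R^-1 : R).
  by rewrite big_tnth sumr_const card_ord -[_ *+ _]mulr_natl divff// gt_eqF.
rewrite big_seq [ltRHS]big_seq; apply: ltr_sum => [|i si].
  by apply/hasP; exists i0; rewrite mem_head.
by rewrite -[ltRHS]mulr1 ltr_pdivlMl// H.
Qed.

End Modulus.

(** * Lagrange interpolation *)

Section Lagrange.
Variable F : fieldType.
Implicit Types (s : seq F) (f : {poly F}).

Definition rootsP s : {poly F} := \prod_(y <- s) ('X - y%:P).

Lemma rootsP_horner s x : (rootsP s).[x] = \prod_(y <- s) (x - y).
Proof. by rewrite horner_prod; apply: eq_bigr => y _; rewrite hornerXsubC. Qed.

Lemma rootsP_rem s x : x \in s ->
  rootsP s = ('X - x%:P) * rootsP (rem x s).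
Proof.
by move=> xs; rewrite /rootsP (perm_big _ (perm_to_rem xs)) big_cons.
Qed.

Lemma rootsP_neq0 s x : x \notin s -> (rootsP s).[x] != 0.
Proof. by rewrite -root_prod_XsubC. Qed.

(** The value of [rootsP (rem x s)] at x is the derivative of [rootsP s] there,
    so this is the classical formula with p'(x) in the denominators. *)
Lemma lagrange_interpolation s f : uniq s -> (size f <= size s)%N ->
  f = \sum_(x <- s) (f.[x] / (rootsP (rem x s)).[x]) *: rootsP (rem x s).
Proof.
move=> us fs; apply/eqP; rewrite -subr_eq0; apply/eqP.
set g := f - _.
apply: (@roots_geq_poly_eq0 _ g s) => //.
  apply/allP => x xs; rewrite /root /g hornerD hornerN horner_sum.
  rewrite (perm_big _ (perm_to_rem xs)) big_cons big_seq big1 => [|y].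
    rewrite /= addr0 hornerZ divfK ?subrr ?eqxx//.
    by rewrite rootsP_neq0// mem_rem_uniqF.
  rewrite mem_rem_uniq// inE => /andP[yx ys].
  by rewrite hornerZ [X in _ * X](_ : _ = 0) ?mulr0//; apply/eqP;
    rewrite -rootE root_prod_XsubC mem_rem_uniq// inE eq_sym yx xs.
rewrite (leq_trans (size_polyD _ _))// geq_max fs/= size_polyN.
rewrite big_seq; apply: (leq_trans (size_sum _ _ _)).
apply/bigmax_leqP_seq => x xs _.
rewrite (leq_trans (size_scale_leq _ _))// size_prod_XsubC size_rem//.
by rewrite prednK//; case: (s) xs.
Qed.

(** Compares the coefficients of degree [(size s).-1] in the interpolation
    formula: each [rootsP (rem x s)] is monic of that degree. *)
Lemma lead_coef_lagrange s f : uniq s -> f \is monic -> size f = size s ->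
  \sum_(x <- s) f.[x] / (rootsP (rem x s)).[x] = 1.
Proof.
move=> us /monicP fm fs.
rewrite -fm lead_coefE {2}(lagrange_interpolation us (eq_leq fs)).
rewrite coef_sum big_seq [RHS]big_seq; apply: eq_bigr => x xs.
rewrite coefZ fs -(size_rem xs) (_ : _`_ _ = 1) ?mulr1//.
have /monicP <- : rootsP (rem x s) \is monic by exact: monic_prod_XsubC.
by rewrite lead_coefE size_prod_XsubC.
Qed.

End Lagrange.

(** * Products of mutual distances *)

Section Vandermonde.
Variable R : realType.
Implicit Types (x y : R[i]) (s : seq R[i]) (A : set R[i]).

(** For x in s, [gap (rem x s) x] is the modulus of the derivative at x of the
    monic polynomial with zeros s. *)
Definition gap s x : R := normc (rootsP s).[x].

(** The modulus of the Vandermonde determinant of s. *)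
Fixpoint vandermonde s : R :=
  if s is x :: s' then gap s' x * vandermonde s' else 1.

Lemma gapE s x : gap s x = \prod_(y <- s) normc (x - y).
Proof. by rewrite /gap rootsP_horner normc_prod. Qed.

Lemma gap_ge0 s x : 0 <= gap s x. Proof. exact: normc_ge0. Qed.

Lemma vandermonde_ge0 s : 0 <= vandermonde s.
Proof. by elim: s => //= x s IH; rewrite mulr_ge0 ?gap_ge0. Qed.

Lemma vandermonde_cat s1 s2 : vandermonde (s1 ++ s2) =
  vandermonde s1 * vandermonde s2 * \prod_(x <- s1) gap s2 x.
Proof.
elim: s1 => [|x s1 IH] /=; first by rewrite big_nil mul1r mulr1.
rewrite IH big_cons (_ : gap (s1 ++ s2) x = gap s1 x * gap s2 x); first by ring.
by rewrite !gapE big_cat.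
Qed.

Lemma vandermonde_perm s1 s2 :
  perm_eq s1 s2 -> vandermonde s1 = vandermonde s2.
Proof.
apply: catCA_perm_subst => a b c.
have gap_cat u v x : gap (u ++ v) x = gap u x * gap v x.
  by rewrite !gapE big_cat.
rewrite !vandermonde_cat (eq_bigr _ (fun x _ => gap_cat b c x)).
rewrite (eq_bigr _ (fun x _ => gap_cat a c x)) !big_split/=.
have -> : \prod_(x <- b) gap a x = \prod_(x <- a) gap b x.
  under eq_bigr do rewrite gapE.
  rewrite exchange_big/=; apply: eq_bigr => x _; rewrite gapE.
  by apply: eq_bigr => y _; rewrite normcBC.
by ring.
Qed.

Lemma vandermonde_rem s x : x \in s ->
  vandermonde s = gap (rem x s) x * vandermonde (rem x s).
Proof. by move=> xs; rewrite (vandermonde_perm (perm_to_rem xs)). Qed.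

Lemma gap_eq0 s x : (gap s x == 0) = (x \in s).
Proof. by rewrite normc_eq0 -root_prod_XsubC. Qed.

Lemma vandermonde_eq0 s : (vandermonde s == 0) = ~~ uniq s.
Proof.
elim: s => [|x s IH] /=; first by rewrite oner_eq0.
by rewrite mulf_eq0 IH gap_eq0 negb_and negbK.
Qed.

(** In 1 = sum_x Q(x) / p'(x) one of the terms has modulus at least 1 / n. *)
Lemma small_gap s (Q : {poly R[i]}) (M : R) : uniq s ->
  Q \is monic -> size Q = size s -> {in s, forall x, normc Q.[x] <= M} ->
  exists2 x, x \in s & gap (rem x s) x <= (size s)%:R * M.
Proof.
move=> us Qm Qs QM.
have [x xs] := normc_sum1_pigeonhole (lead_coef_lagrange us Qm Qs).
rewrite Normc.normcM Normc.normcV => h; exists x => //.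
have g0 : 0 < gap (rem x s) x by rewrite lt0r gap_ge0 gap_eq0 mem_rem_uniqF.
apply: (@le_trans _ _ ((size s)%:R * normc Q.[x])).
  by move: h; rewrite mulrA -/(gap _ _) ler_pdivlMr// mul1r.
by rewrite ler_wpM2l ?QM.
Qed.

Definition all_in A s := {in s, forall x, A x}.

(** Removing a point with a small gap reduces a list of n+1 points to one of n
    points and costs a factor (n+1) sup|Q_n|. *)
Lemma vandermonde_le A (Q : nat -> {poly R[i]}) (M : nat -> R) s :
  (forall k, Q k \is monic) -> (forall k, size (Q k) = k.+1) ->
  (forall k x, A x -> normc (Q k).[x] <= M k) ->
  all_in A s ->
  vandermonde s <= (size s)`!%:R * \prod_(k < size s) M k.
Proof.
move=> Qm Qs QM; have [n sn] := ubnP (size s); elim: n s sn => // n IH s.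
rewrite ltnS => sn sA.
have [s0|s0] := eqVneq s [::]; first by rewrite s0/= big_ord0 mulr1.
have [us|nus] := boolP (uniq s); last first.
  have := nus; rewrite -vandermonde_eq0 => /eqP ->.
  have [a as_] : exists a, a \in s.
    by case: s {sA sn nus} s0 => // a s _; exists a; rewrite mem_head.
  rewrite mulr_ge0 ?ler0n// prodr_ge0// => k _.
  by rewrite (le_trans (normc_ge0 _) (QM k a (sA a as_))).
have szs : size s = (size s).-1.+1 by rewrite prednK// lt0n size_eq0.
have [||x xs xM] := @small_gap s (Q (size s).-1) (M (size s).-1) us (Qm _).
- by rewrite Qs.
- by move=> x xs; exact: QM (sA _ xs).
have rs := size_rem xs.
rewrite (vandermonde_rem xs) szs factS natrM big_ord_recr/= -szs mulrACA.
rewrite [X in _ <= X * _]mulrC mulrAC mulrA [X in _ <= X * _]mulrC.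
have {}IH := IH (rem x s).
have : vandermonde (rem x s) <= (size s).-1`!%:R * \prod_(k < (size s).-1) M k.
  rewrite -rs; apply: IH; first by rewrite rs -szs.
  by move=> y /mem_rem; exact: sA.
move=> /(ler_pM (gap_ge0 _ _) (vandermonde_ge0 _) xM)/le_trans; apply.
by rewrite le_eqVlt; apply/orP; left; apply/eqP; ring.
Qed.

End Vandermonde.

(** * Lower bound for monic polynomials *)

Section Chebyshev.
Variable R : realType.
Implicit Types (A : set R[i]).

Lemma sum_divn d m : (0 < d)%N -> (\sum_(k < d * m) k %/ d = d * 'C(m, 2))%N.
Proof.
move=> d0; elim: m => [|m IH]; first by rewrite muln0 big_ord0.
rewrite mulnSr big_split_ord/= IH binS bin1 mulnDr; congr addn.
rewrite (eq_bigr (fun=> m)) ?sum_nat_const ?card_ord// => k _.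
by rewrite mulnC divnMDl// divn_small// addn0.
Qed.

Lemma bin2_natr n : 2 * ('C(n, 2))%:R = n%:R * (n%:R - 1) :> R.
Proof.
elim: n => [|n IH]; first by rewrite mulr0 mul0r.
by rewrite binS bin1 natrD mulrDr IH -natr1; ring.
Qed.

Lemma size_monic_exp (q : {poly R[i]}) d k : q \is monic -> size q = d.+1 ->
  size (q ^+ k) = (d * k).+1.
Proof.
move=> qm qs; have := size_exp q k; rewrite qs /= => <-; rewrite prednK//.
by rewrite lt0n size_poly_eq0 expf_neq0// monic_neq0.
Qed.

(** Implies that the transfinite diameter of A is at least exp L. *)
Definition log_transfinite_ge A (L : R) := forall N, exists s,
  [/\ size s = N, all_in A s & expR (L * ('C(N, 2))%:R) <= vandermonde s].

Lemma fact_le_expn n : (n`! <= n ^ n)%N.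
Proof.
suff H m : (n ^_ m <= n ^ m)%N by rewrite -ffactnn.
by elim: m => // m IH; rewrite ffactnSr expnSr leq_mul// leq_subr.
Qed.

(** The case N = d m of the comparison between the lower bound exp(L N(N-1)/2)
    and the upper bound of [vandermonde_le] for the polynomials
    q^(k / d) X^(k mod d), after taking logarithms and dividing by N / 2.  The
    factor |x|^(k mod d) is estimated by C^d and N! by N^N; both contribute only
    O(N ln N) to the logarithm of the bound. *)
Lemma chebyshev_log A (L C M : R) d m (q : {poly R[i]}) :
  log_transfinite_ge A L -> (forall x, A x -> normc x <= C) -> 1 <= C ->
  (0 < d)%N -> q \is monic -> size q = d.+1 -> 0 < M ->
  (forall x, A x -> normc q.[x] <= M) -> (0 < m)%N ->
  L * (d%:R * m%:R - 1) <=
    2 * ln (d%:R * m%:R) + (m%:R - 1) * ln M + 2 * d%:R * ln C.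
Proof.
move=> hL AC C1 d0 qm qs M0 qM m0.
have [s [sN sA sL]] := hL (d * m)%N.
have C0 : 0 < C by lra.
have := @vandermonde_le R A (fun k => q ^+ (k %/ d) * 'X^(k %% d))
  (fun k => M ^+ (k %/ d) * C ^+ d) s.
have h1 k : q ^+ (k %/ d) * 'X^(k %% d) \is monic.
  by rewrite rpredM ?rpredX ?monicX.
have h2 k : size (q ^+ (k %/ d) * 'X^(k %% d)) = k.+1.
  rewrite size_mul ?monic_neq0 ?rpredX ?monicX// size_polyXn.
  by rewrite (size_monic_exp _ qm qs) addSn addnS /= mulnC -divn_eq.
have h3 k x : A x -> normc (q ^+ (k %/ d) * 'X^(k %% d)).[x] <=
    M ^+ (k %/ d) * C ^+ d.
  move=> Ax; rewrite hornerM hornerXn horner_exp Normc.normcM !normcX.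
  apply: ler_pM; rewrite ?exprn_ge0 ?normc_ge0//.
    by rewrite lerXn2r ?nnegrE ?normc_ge0 ?(ltW M0)// qM.
  rewrite (@le_trans _ _ (C ^+ (k %% d)))//.
    by rewrite lerXn2r ?nnegrE ?normc_ge0 ?(ltW C0)// AC.
  by rewrite ler_weXn2l// ltnW// ltn_pmod.
move=> /(_ h1 h2 h3 sA); rewrite sN big_split/= prodr_const card_ord.
rewrite (_ : \prod_(_ < _) _ = M ^+ (d * 'C(m, 2))%N); last first.
  by rewrite -sum_divn// prodrXr.
move=> /(le_trans sL) H.
have dm0 : (0 < d * m)%N by rewrite muln_gt0 d0.
have {}H : expR (L * ('C(d * m, 2))%:R) <=
  (d%:R * m%:R) ^+ (d * m) * (M ^+ (d * 'C(m, 2)) * (C ^+ d) ^+ (d * m)).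
  apply: (le_trans H).
  rewrite ler_wpM2r ?mulr_ge0 ?exprn_ge0 ?(ltW M0) ?(ltW C0)//.
  by rewrite -natrM -natrX ler_nat fact_le_expn.
have dR : 0 < d%:R :> R by rewrite ltr0n.
have mR : 0 < m%:R :> R by rewrite ltr0n.
move: H; rewrite -ler_ln ?posrE ?expR_gt0//; last first.
  by rewrite ?mulr_gt0 ?exprn_gt0 ?mulr_gt0.
rewrite expRK !lnM ?posrE ?mulr_gt0 ?exprn_gt0 ?mulr_gt0//.
rewrite -exprM !lnXn ?mulr_gt0// -!(mulr_natl (ln _)) !natrM.
have := bin2_natr (d * m); have := bin2_natr m; rewrite !natrM lnM ?posrE//.
set u := ('C(m, 2))%:R; set v := ('C(d * m, 2))%:R => hu hv H.
have : d%:R * m%:R * (L * (d%:R * m%:R - 1)) <= d%:R * m%:R *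
   (2 * (ln d%:R + ln m%:R) + (m%:R - 1) * ln M + 2 * d%:R * ln C).
  have -> : d%:R * m%:R * (L * (d%:R * m%:R - 1)) = 2 * (L * v).
    by rewrite [RHS]mulrCA hv; ring.
  rewrite (_ : d%:R * m%:R * _ =
   2 * (d%:R * m%:R * (ln d%:R + ln m%:R)) + d%:R * (2 * u) * ln M
   + 2 * (d%:R * (d%:R * m%:R) * ln C)); last by rewrite hu; ring.
  lra.
by rewrite ler_pM2l// mulr_gt0.
Qed.

(** In [chebyshev_log] the two sides grow like m d L and m ln M, up to an error
    of size O(ln m), so d L > ln M would be contradictory for large m. *)
Lemma chebyshev_lower_bound A (L C M : R) d (q : {poly R[i]}) :
  log_transfinite_ge A L -> 0 <= L -> (forall x, A x -> normc x <= C) ->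
  (0 < d)%N -> q \is monic -> size q = d.+1 -> 0 < M ->
  (forall x, A x -> normc q.[x] <= M) -> d%:R * L <= ln M.
Proof.
move=> hL L0 AC d0 qm qs M0 qM; rewrite leNgt; apply/negP => hlt.
set C' := Num.max C 1.
have C'1 : 1 <= C' by rewrite le_max lexx orbT.
have AC' x : A x -> normc x <= C' by move=> /AC h; rewrite le_max h.
have dR : 1 <= d%:R :> R by rewrite ler1n.
have H m := chebyshev_log hL AC' C'1 d0 qm qs M0 qM (ltn0Sn m).
set e := d%:R * L - ln M; have e0 : 0 < e by rewrite subr_gt0.
set c := 2 * ln d%:R + 2 * d%:R * ln C'.
have c0 : 0 <= c by rewrite addr_ge0// !mulr_ge0// ?ln_ge0.
(* With m = k^2 + 1, ln m <= 2 ln (k + 1) <= 2 k is elementary. *)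
have {}H (k : nat) : k%:R ^+ 2 * e <= 4 * k%:R + c.
  have := H (k ^ 2)%N; rewrite lnM ?posrE ?ltr0n// -natr1 natrX.
  have k1 : 0 < k%:R + 1 :> R by rewrite natr1 ltr0n.
  have : ln (k%:R ^+ 2 + 1) <= 2 * k%:R :> R.
    have : ln (k%:R ^+ 2 + 1) <= ln ((k%:R + 1) ^+ 2) :> R.
      have p1 : 0 < k%:R ^+ 2 + 1 :> R by rewrite ltr_wpDl ?sqr_ge0.
      rewrite ler_ln ?posrE ?exprn_gt0//.
      by have : 0 <= k%:R :> R by []; nra.
    move=> /le_trans; apply; rewrite lnXn// -(mulr_natl (ln _)) ler_pM2l//.
    by rewrite addrC le_ln1Dx// (lt_le_trans _ (ler0n _ _)).
  rewrite addrK /c /e; set l := ln (_ + 1); set y := k%:R.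
  have y0 : 0 <= y ^+ 2 by rewrite sqr_ge0.
  have : L * (d%:R * (y ^+ 2 + 1) - 1) >= L * (d%:R * y ^+ 2).
    by rewrite ler_wpM2l//; nra.
  by nra.
have [k hk] : exists k : nat, (4 + c) / e + 1 < k%:R.
  by exists (Num.truncn ((4 + c) / e + 1)).+1; rewrite truncnS_gt.
have := H k; apply/negP; rewrite -ltNge.
have f0 : 0 <= (4 + c) / e by rewrite divr_ge0 ?(ltW e0)//; lra.
have : (4 + c) < k%:R * e by rewrite -ltr_pdivrMr//; lra.
have k1 : 1 < k%:R :> R by lra.
rewrite expr2 -mulrA; set y := k%:R * e; nra.
Qed.

End Chebyshev.

(** * Nearly extremal points and the covering of the lemniscate *)

Section Fekete.
Variable R : realType.
Implicit Types (A : set R[i]) (s : seq R[i]).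

(** For s take a list whose product of distances exceeds half of the supremum:
    exchanging x for y multiplies the product by
    [gap (rem x s) y / gap (rem x s) x], which is therefore at most 2. *)
Lemma near_fekete A (C : R) n : (forall x, A x -> normc x <= C) ->
  (exists s, [/\ size s = n, all_in A s & 0 < vandermonde s]) ->
  exists s, [/\ size s = n, all_in A s, uniq s &
    {in s, forall x, forall y, A y -> gap (rem x s) y <= 2 * gap (rem x s) x}].
Proof.
move=> AC [s0 [s0n s0A s0V]].
pose E := [set vandermonde s | s in [set s | size s = n /\ all_in A s]].
have E0 : E (vandermonde s0) by exists s0.
(* vandermonde_le for the monomials X^k, bounded by C^k on A *)
have Eub : has_ubound E.
  exists (n`!%:R * \prod_(k < n) C ^+ k) => _ [s [sn sA] <-]; rewrite -sn.
  apply: (@vandermonde_le R A (fun k => 'X^k) (fun k => C ^+ k)) => //.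
  - exact: monicXn.
  - exact: size_polyXn.
  - move=> k x /AC xC; rewrite hornerXn normcX lerXn2r// nnegrE ?normc_ge0//.
    exact: le_trans (normc_ge0 _) xC.
have Es : has_sup E by split => //; exists (vandermonde s0).
have S0 : 0 < sup E by rewrite (lt_le_trans s0V)// sup_upper_bound.
have [_ [s [sn sA] <-] sV] := sup_adherent (divr_gt0 S0 (@ltr0n R 2)) Es.
have {}sV : sup E < 2 * vandermonde s by lra.
have V0 : 0 < vandermonde s by lra.
have us : uniq s by rewrite -[uniq s]negbK -vandermonde_eq0 gt_eqF.
exists s; split => // x xs y Ay.
have : vandermonde (y :: rem x s) <= 2 * vandermonde s.
  rewrite (le_trans _ (ltW sV))// sup_upper_bound//.
  exists (y :: rem x s) => //.
  split; first by rewrite /= size_rem// prednK//; case: (s) xs.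
  by move=> w; rewrite inE => /predU1P[->//|/mem_rem]; exact: sA.
rewrite (vandermonde_rem xs) mulrA ler_pM2r// lt0r vandermonde_ge0 andbT.
by rewrite vandermonde_eq0 negbK rem_uniq.
Qed.

(** [chebyshev_lower_bound] applied to the polynomials with zeros [rem x s],
    whose supremum on A is controlled by their value at x. *)
Lemma fekete_separation A (T C : R) n : 0 < T ->
  (forall L, L < T -> log_transfinite_ge A L) ->
  (forall x, A x -> normc x <= C) ->
  exists s, [/\ size s = n.+2, all_in A s, uniq s &
    {in s, forall x, expR (n.+1%:R * T) <= 2 * gap (rem x s) x}].
Proof.
move=> T0 hT AC.
have [s [sn sA us sgap]] : exists s, [/\ size s = n.+2, all_in A s, uniq s &
    {in s, forall x, forall y, A y -> gap (rem x s) y <= 2 * gap (rem x s) x}].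
  apply: (near_fekete AC); have [s [sn sA sV]] := hT 0 T0 n.+2.
  by exists s; split => //; rewrite (lt_le_trans _ sV)// expR_gt0.
exists s; split => // x xs.
have g0 : 0 < 2 * gap (rem x s) x.
  by rewrite mulr_gt0// lt0r gap_ge0 gap_eq0 mem_rem_uniqF.
rewrite -ler_ln ?posrE ?expR_gt0// expRK -ler_pdivlMl ?ltr0n//.
suff H L : 0 <= L -> L < T -> L <= n.+1%:R^-1 * ln (2 * gap (rem x s) x).
  apply/ler_addgt0Pr => e e0; rewrite -lerBlDr.
  have LT : T - e < T by lra.
  have [/H->//|L0] := lerP 0 (T - e).
  exact: le_trans (ltW L0) (H 0 _ _).
move=> L0 LT; rewrite ler_pdivlMl ?ltr0n//.
apply: (@chebyshev_lower_bound _ A L C _ n.+1 (rootsP (rem x s))) => //.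
- exact: hT.
- exact: monic_prod_XsubC.
- by rewrite size_prod_XsubC size_rem// sn.
- by move=> y; exact: sgap.
Qed.

(** Let p have zeros s.  In 1 = sum_x p(z) / (p'(x) (z - x)) the term of some x
    is at least 1 / n, whence |z - x| |p'(x)| <= n |p(z)| < n. *)
Lemma lemniscate_cover s (a : R) z : uniq s -> 0 < a ->
  {in s, forall x, a <= gap (rem x s) x} -> normc (rootsP s).[z] < 1 ->
  exists2 x, x \in s & normc (z - x) < (size s)%:R / a.
Proof.
move=> us a0 sa pz.
have s0 : (0 < size s)%N.
  case: s pz {us sa} => //.
  by rewrite /rootsP big_nil hornerE Normc.normc1 ltxx.
have s1 : (size (1%:P : {poly R[i]}) <= size s)%N.
  by rewrite size_polyC oner_eq0.
have sum1 :
    \sum_(x <- s) (rootsP (rem x s)).[z] / (rootsP (rem x s)).[x] = 1.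
  rewrite -[RHS](hornerC 1 z) [in RHS](lagrange_interpolation us s1) horner_sum.
  by apply: eq_bigr => x _; rewrite hornerC hornerZ mul1r mulrC.
have [x xs] := normc_sum1_pigeonhole sum1.
rewrite Normc.normcM Normc.normcV mulrA -/(gap _ _) => h; exists x => //.
have g0 : 0 < gap (rem x s) x by rewrite (lt_le_trans a0)// sa.
move: h; rewrite ler_pdivlMr// mul1r => h.
move: pz; rewrite (rootsP_rem xs) hornerM hornerXsubC Normc.normcM => pz.
rewrite ltr_pdivlMr//.
apply: (@le_lt_trans _ _
  ((size s)%:R * (normc (z - x) * normc (rootsP (rem x s)).[z]))).
  rewrite mulrCA ler_wpM2l ?normc_ge0//.
  exact: le_trans (sa _ xs) h.
by rewrite gtr_pMr// ltr0n.
Qed.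

End Fekete.

(** * Area of lemniscates *)

Section Plane.
Variable R : realType.
Local Notation P := (R * R)%type.

Definition dist (z w : P) : R := normc (toC z - toC w).

Lemma distE z w : dist z w = Num.sqrt ((z.1 - w.1) ^+ 2 + (z.2 - w.2) ^+ 2).
Proof. by []. Qed.

Lemma toC_inj : injective (@toC R).
Proof. by move=> [a b] [c d] [-> ->]. Qed.

Lemma measurable_dist d (T : measurableType d) (f g : T -> P) :
  measurable_fun setT f -> measurable_fun setT g ->
  measurable_fun setT (fun x => dist (f x) (g x)).
Proof.
move=> mf mg.
apply: (measurableT_comp (continuous_measurable_fun (@sqrt_continuous R))).
have h1 h : measurable_fun setT h ->
    measurable_fun setT (fun x : T => (h x : P).1).
  by move=> mh; exact: measurableT_comp measurable_fst mh.
have h2 h : measurable_fun setT h ->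
    measurable_fun setT (fun x : T => (h x : P).2).
  by move=> mh; exact: measurableT_comp measurable_snd mh.
apply: measurable_funD; apply: measurable_funX; apply: measurable_funB.
- exact: h1.
- exact: h1.
- exact: h2.
- exact: h2.
Qed.

Lemma dist_coord_le z w :
  `|z.1 - w.1| <= dist z w /\ `|z.2 - w.2| <= dist z w.
Proof.
rewrite distE; split; rewrite -sqrtr_sqr ler_wsqrtr//.
  by rewrite lerDl sqr_ge0.
by rewrite lerDr sqr_ge0.
Qed.

Lemma normc_rootsP (s : seq P) z :
  normc (rootsP (map toC s)).[toC z] = \prod_(x <- s) dist z x.
Proof. by rewrite rootsP_horner normc_prod big_map. Qed.

Lemma measurable_lemniscate (s : seq P) :
  measurable (lemniscate (rootsP (map toC s))).
Proof.
have -> : lemniscate (rootsP (map toC s)) =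
    (fun z => \prod_(x <- s) dist z x) @^-1` `]-oo, 1[.
  by apply/seteqP; split => z /=; rewrite /lemniscate/= normc_rootsP in_itv.
rewrite -[X in measurable X]setTI; apply: measurable_prod => // x _.
by apply: measurable_dist => //; exact: measurable_id.
Qed.

Definition square (x : P) (r : R) : set P :=
  `]x.1 - r, x.1 + r[ `*` `]x.2 - r, x.2 + r[.

Lemma measurable_square x r : measurable (square x r).
Proof. exact: measurableX. Qed.

Lemma area_square x r : 0 <= r -> area (square x r) = ((2 * r) ^+ 2)%:E.
Proof.
move=> r0; rewrite /area product_measure1E//= !lebesgue_measure_itv/= !lte_fin.
have [r_gt0|r_le0] := ltP 0 r.
  rewrite !ifT; [|lra|lra].
  by rewrite -!EFinB -EFinM; congr EFin; ring.
have -> : r = 0 by apply/le_anti; rewrite r0 r_le0.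
by rewrite addr0 subr0 ltxx mul0e mulr0 expr0n.
Qed.

Lemma area_lemniscate_le (s : seq P) (a : R) : uniq s -> 0 < a ->
  {in map toC s, forall x, a <= gap (rem x (map toC s)) x} ->
  (area (lemniscate (rootsP (map toC s))) <=
    ((size s)%:R * (2 * ((size s)%:R / a)) ^+ 2)%:E)%E.
Proof.
move=> us a0 sa; set r := (size s)%:R / a.
have r0 : 0 <= r by rewrite divr_ge0// ltW.
pose A i := square (nth (0, 0) s i) r.
apply: (@le_trans _ _ (\sum_(i < size s) area (A i))%E).
  apply: content_subadditive => //.
  - by move=> i _; exact: measurable_square.
  - exact: measurable_lemniscate.
  - move=> z /= pz.
    have us' : uniq (map toC s) by rewrite (map_inj_uniq toC_inj).
    have [_ /mapP[x xs ->]] := lemniscate_cover us' a0 sa pz.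
    rewrite size_map -/r -/(dist z x) => zx; rewrite -bigcup_mkord.
    exists (index x s) => /=; first by rewrite index_mem.
    have [h1 h2] := dist_coord_le z x.
    rewrite /A nth_index// /square; split => /=; rewrite in_itv/=.
      by move: (le_lt_trans h1 zx); rewrite ltr_distl.
    by move: (le_lt_trans h2 zx); rewrite ltr_distl.
under eq_bigr do rewrite area_square//.
by rewrite sumEFin sumr_const card_ord -[_ *+ _]mulr_natl.
Qed.
End Plane.

(** * Integration against a probability measure carried by a set *)

Section Mass1.
Context d (T : measurableType d) (R : realType) (mu : probability T R).
Variables (K : set T).
Hypotheses (mK : measurable K) (muK : mu K = 1%E).
Local Open Scope ereal_scope.

Lemma integral_mass1_cst (a : R) : \int[mu]_(x in K) a%:E = a%:E.
Proof.
have := integral_cst mu mK a%:E; rewrite /cst => ->.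
by rewrite [X in _ * X]muK mule1.
Qed.

(** Linearity holds even if h has infinite integral, which occurs for the
    logarithmic kernel: the positive part of a - h is bounded, so both sides
    are then -oo. *)
Lemma integral_mass1_subl (a : R) (h : T -> \bar R) :
  measurable_fun K h -> (forall x, K x -> 0 <= h x) ->
  \int[mu]_(x in K) (a%:E - h x) = a%:E - \int[mu]_(x in K) h x.
Proof.
move=> mh h0.
have ia : mu.-integrable K (EFin \o cst a).
  exact: finite_measure_integrable_cst.
have [hfin|] := ltP (\int[mu]_(x in K) h x) +oo.
  rewrite (integralB mK ia) ?integral_mass1_cst//.
  apply/integrableP; split => //.
  under eq_integral => x /set_mem Kx do rewrite gee0_abs ?h0//.
  by [].
rewrite leye_eq => /eqP hoo; rewrite hoo.
have mah : measurable_fun K (fun x => a%:E - h x).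
  by apply: emeasurable_funB.
rewrite integralE.
have -> : \int[mu]_(x in K) (fun x => a%:E - h x)^\- x = +oo.
  have : +oo <= \int[mu]_(x in K) ((fun x => a%:E - h x)^\- x + (`|a|)%:E).
    rewrite -hoo; apply: ge0_le_integral => //.
      apply: emeasurable_funD => //; exact: measurable_funeneg.
    move=> x Kx; rewrite funenegE oppeB ?fin_num_adde_defr//.
    case: (h x) (h0 _ Kx) => [r| |]//= r0.
    rewrite -EFinD -EFin_max -EFinD lee_fin.
    have := ler_norm a.
    have : (- a + r <= Num.max (- a + r) 0)%R by rewrite le_max lexx.
    lra.
  rewrite ge0_integralD//; last exact: measurable_funeneg.
  rewrite integral_mass1_cst leye_eq.
  by case: (integral _ _ _) => [r| |].
have : \int[mu]_(x in K) (fun x => a%:E - h x)^\+ x <= `|a|%:E.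
  rewrite -[leRHS]integral_mass1_cst; apply: ge0_le_integral => //.
    exact: measurable_funepos.
  move=> x Kx; rewrite funeposE ge_max lee_fin normr_ge0 andbT.
  apply: (@le_trans _ _ a%:E); last by rewrite lee_fin ler_norm.
  by rewrite -[leRHS]sube0 leeB// h0.
by case: (integral _ _ _) => [r| |].
Qed.

(** Otherwise h would exceed its integral at every point of K, and its excess
    would be a positive function with zero integral. *)
Lemma integral_mass1_attained (h : T -> \bar R) :
  measurable_fun K h -> (forall x, K x -> 0 <= h x) ->
  exists2 x, K x & h x <= \int[mu]_(x in K) h x.
Proof.
move=> mh h0; apply: contrapT => H.
have {}H x : K x -> \int[mu]_(x in K) h x < h x.
  by move=> Kx; rewrite ltNge; apply/negP => hx; apply: H; exists x.
have muK0 : mu K <> 0 by rewrite [mu K]muK; apply/eqP; rewrite onee_neq0.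
have [x0 Kx0] : K !=set0.
  by apply/set0P/eqP => K0; apply: muK0; rewrite K0 measure0.
have Ifin : \int[mu]_(x in K) h x \is a fin_num.
  rewrite ge0_fin_numE ?integral_ge0//.
  exact: (lt_le_trans (H _ Kx0) (leey _)).
pose c := fine (\int[mu]_(x in K) h x).
have cE : \int[mu]_(x in K) h x = c%:E by rewrite /c fineK.
have ih : mu.-integrable K h.
  apply/integrableP; split => //.
  under eq_integral => x /set_mem Kx do rewrite gee0_abs ?h0//.
  by rewrite cE ltry.
have ic : mu.-integrable K (EFin \o cst c).
  exact: finite_measure_integrable_cst.
have : \int[mu]_(x in K) `|h x - c%:E| = 0.
  under eq_integral => x /set_mem Kx.
    by rewrite gee0_abs; [over|rewrite sube_ge0 ?ltW// -cE H].
  by rewrite (integralB mK ih ic) cE integral_mass1_cst subee.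
move/(ae_eq_integral_abs mu mK).
case; first by apply: emeasurable_funB.
move=> N [mN muN KN]; apply: muK0; apply/eqP; rewrite -measure_le0 -muN.
rewrite le_measure ?inE// => x Kx; apply: KN => /= /(_ Kx) hx.
have := H _ Kx; rewrite cE; case: (h x) hx => [r| |]//.
by rewrite -EFinB => -[/eqP]; rewrite subr_eq0 => /eqP ->; rewrite ltxx.
Qed.

End Mass1.

(** * Compact subsets of the plane *)

Section Borel.
Variable R : realType.
Local Notation P := (R * R)%type.

(** The measurable structure of the plane is a product structure, so an open set
    has to be exhibited as a countable union of rectangles: squares with
    rational centre and side 2 / (n + 1). *)
Lemma open_measurable_plane (U : set P) : open U -> measurable U.
Proof.
move=> oU.
pose sq (i : rat * rat * nat) : set P :=
  square (ratr i.1.1, ratr i.1.2) (i.2.+1%:R^-1).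
have -> : U = \bigcup_(i in [set i | sq i `<=` U]) sq i.
  apply/seteqP; split => [z Uz|z [i /= iU /iU//]].
  have /nbhs_ballP[e /= e0 eU] : nbhs z U by exact: open_nbhs_nbhs.
  have [n ne] : exists n : nat, 2 * n.+1%:R^-1 < e.
    exists (Num.truncn (2 / e)); rewrite -ltr_pdivlMl// -[ltRHS]invrK.
    rewrite ltf_pV2 ?posrE ?invr_gt0 ?mulr_gt0// invfM invrK mulrC.
    exact: truncnS_gt.
  have r0 : 0 < n.+1%:R^-1 :> R by rewrite invr_gt0 ltr0n.
  set r : R := n.+1%:R^-1 in ne r0.
  have approx (a : R) : exists q : rat, `|a - ratr q| < r.
    have [|q] := @rat_in_itvoo R (a - r) (a + r); first by lra.
    rewrite in_itv/= => /andP[q1 q2]; exists q.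
    by rewrite ltr_norml; lra.
  have [q1 hq1] := approx z.1; have [q2 hq2] := approx z.2.
  have zq : sq (q1, q2, n) z.
    by split => /=; rewrite in_itv/= -ltr_distl.
  exists (q1, q2, n) => //= w [/=]; rewrite !in_itv/= -!ltr_distl => h1 h2.
  apply: eU; split; rewrite /ball/=.
    rewrite -(subrK (ratr q1) z.1) -addrA (le_lt_trans (ler_normD _ _))//.
    by rewrite (distrC (ratr q1)); rewrite -/r in h1; lra.
  rewrite -(subrK (ratr q2) z.2) -addrA (le_lt_trans (ler_normD _ _))//.
  by rewrite (distrC (ratr q2)); rewrite -/r in h2; lra.
rewrite bigcup_mkcond; apply: countable_bigcupT_measurable => // i.
by case: ifP => _ //; exact: measurable_square.
Qed.

Lemma compact_measurable_plane (K : set P) : compact K -> measurable K.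
Proof.
move=> /(compact_closed (@norm_hausdorff _ _)) /closed_openC.
by move=> /open_measurable_plane/measurableC; rewrite setCK.
Qed.

Lemma compact_bounded_plane (K : set P) : compact K ->
  exists C, forall z, K z -> normc (toC z) <= C.
Proof.
move=> /compact_bounded[M [_ HM]]; exists (2 * (`|M| + 1)) => z Kz.
have : `|z| <= `|M| + 1.
  by apply: HM => //; rewrite (le_lt_trans (ler_norm _))// ltrDl.
rewrite prod_normE ge_max => /andP[z1 z2].
have -> : toC z = toC (z.1, 0) + toC (0, z.2).
  rewrite /toC/= -[LHS]/(_ +i* _)%C; apply/eqP.
  by rewrite eq_complex/= addr0 add0r !eqxx.
rewrite (le_trans (ler_normcD _ _))// mulrDl mul1r lerD//.
  by rewrite /toC/= expr0n addr0 sqrtr_sqr.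
by rewrite /toC/= expr0n add0r sqrtr_sqr.
Qed.

End Borel.

(** * Points with large mutual distances *)

Section Kernel.
Variable R : realType.
Local Notation P := (R * R)%type.
Variable D : R.
Local Open Scope ereal_scope.

(** The kernel log (D / |z - w|), truncated at 0.  On a set of diameter at most
    D the truncation has no effect, and a kernel with values in [0, +oo] can be
    integrated and summed without integrability conditions. *)
Definition kern (z w : P) : \bar R := maxe ((ln D)%:E - lne (dist z w)%:E) 0.

Lemma kern_ge0 z w : 0 <= kern z w.
Proof. by rewrite le_max lexx orbT. Qed.

Lemma kernE z w : (0 < D)%R -> (dist z w <= D)%R ->
  lne (dist z w)%:E = (ln D)%:E - kern z w.
Proof.
move=> D0 zwD; rewrite /kern.
have [d0|d0] := leP (dist z w) 0%R.
  by rewrite le0_lneNy ?lee_fin//= max_l.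
rewrite lne_EFin// -EFinB max_l ?lee_fin ?subr_ge0 ?ler_ln ?posrE//.
by rewrite -EFinB opprB addrC subrK.
Qed.

Lemma kern_le z w e : kern z w <= e%:E -> (expR (ln D - e) <= dist z w)%R.
Proof.
rewrite /kern ge_max => /andP[+ _].
have [d0|d0] := leP (dist z w) 0%R; first by rewrite le0_lneNy ?lee_fin.
rewrite lne_EFin// -EFinB lee_fin => h.
by rewrite -ler_ln ?posrE ?expR_gt0// expRK; lra.
Qed.

Lemma measurable_kern d (T : measurableType d) (f g : T -> P) :
  measurable_fun setT f -> measurable_fun setT g ->
  measurable_fun setT (fun x => kern (f x) (g x)).
Proof.
move=> mf mg; apply: measurable_maxe => //; apply: emeasurable_funB => //.
pose l (r : R) := lne r%:E.
have ml : measurable_fun setT l.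
  rewrite /l /=; apply: measurable_fun_ifT => //; last first.
    by apply/measurable_EFinP; exact: measurable_ln.
  exact: measurable_fun_ler.
exact: measurableT_comp ml (measurable_dist mf mg).
Qed.

End Kernel.

Section Greedy.
Variable R : realType.
Local Notation P := (R * R)%type.
Variables (mu : probability P R) (K : set P) (D : R).
Hypotheses (mK : measurable K) (muK : mu K = 1%E).
Local Open Scope ereal_scope.

Definition kern_potential (z : P) : \bar R := \int[mu]_(w in K) kern D z w.
Definition kern_energy : \bar R := \int[mu]_(z in K) kern_potential z.

Lemma kern_potential_ge0 z : 0 <= kern_potential z.
Proof. by apply: integral_ge0 => w _; exact: kern_ge0. Qed.

Lemma kern_energy_ge0 : 0 <= kern_energy.
Proof. by apply: integral_ge0 => w _; exact: kern_potential_ge0. Qed.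

Lemma measurable_kern1 z : measurable_fun K (kern D z).
Proof.
by apply: measurable_funTS; apply: measurable_kern.
Qed.

(** Extending the kernel by 0 outside K turns the potential into a partial
    integral over the whole plane, measurable by Tonelli's theorem. *)
Lemma measurable_kern_potential : measurable_fun K kern_potential.
Proof.
pose f (x : P * P) := ((fun y => kern D y.1 y.2) \_ (setT `*` K)) x.
have mf : measurable_fun setT f.
  apply/(measurable_restrictT _ (measurableX measurableT mK)).
  by apply: measurable_funTS; exact: measurable_kern.
have f0 x : 0 <= f x.
  by rewrite /f patchE; case: ifP => // _; exact: kern_ge0.
have := @measurable_fun_fubini_tonelli_F _ _ _ _ R mu f mf f0.
move=> /(measurable_funS measurableT (@subsetT _ K)); apply: eq_measurable_fun.
move=> z _; rewrite /fubini_F /kern_potential [RHS]integral_mkcond.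
by apply: eq_integral => w _; rewrite /f !patchE in_setX/= in_setT.
Qed.

Lemma log_energy_kern_energy : (0 < D)%R ->
  (forall z w, K z -> K w -> (dist z w <= D)%R) ->
  log_energy K mu = (ln D)%:E - kern_energy.
Proof.
move=> D0 KD; rewrite /log_energy.
rewrite -(integral_mass1_subl mK muK); last 2 first.
- exact: measurable_kern_potential.
- by move=> z _; exact: kern_potential_ge0.
apply: eq_integral => z /set_mem Kz; rewrite /log_potential.
rewrite -(integral_mass1_subl mK muK); last 2 first.
- exact: measurable_kern1.
- by move=> w _; exact: kern_ge0.
by apply: eq_integral => w /set_mem Kw; rewrite -kernE// KD.
Qed.

Fixpoint discrete_energy (s : seq P) : \bar R :=
  if s is z :: s' then \sum_(w <- s') kern D z w + discrete_energy s' else 0.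

Lemma discrete_energy_ge0 s : 0 <= discrete_energy s.
Proof.
by elim: s => //= z s IH; rewrite adde_ge0// sume_ge0// => w _; exact: kern_ge0.
Qed.

Lemma kern_sym z w : kern D z w = kern D w z.
Proof. by rewrite /kern /dist normcBC. Qed.

(** Let U and J be the potential and the energy of mu for the kernel
    k = [kern D].  Given s, the mean over z in K (for mu) of
    sum_(w in s) k(w, z) + r U(z) is sum_(w in s) U(w) + r J.  Adding to s a
    point z where this function does not exceed its mean preserves the bound, r
    being the number of points still to be added; this is the method of
    conditional expectations for r independent points of law mu. *)
Lemma greedy_points r s : exists s', [/\ size s' = r,
  {in s', forall z, K z} &
  discrete_energy (s' ++ s) <=
    discrete_energy s + r%:R%:E * (\sum_(w <- s) kern_potential w)
    + ('C(r, 2))%:R%:E * kern_energy].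
Proof.
elim: r s => [|r IH] s.
  by exists [::]; split => //=; rewrite bin0n !mul0e !adde0.
pose h z := \sum_(w <- s) kern D w z + r%:R%:E * kern_potential z.
have rk : forall z, K z -> 0 <= r%:R%:E * kern_potential z.
  by move=> z _; rewrite mule_ge0 ?lee_fin ?kern_potential_ge0.
have mrk : measurable_fun K (fun z => r%:R%:E * kern_potential z).
  by apply: emeasurable_funM => //; exact: measurable_kern_potential.
have msk : measurable_fun K (fun z => \sum_(w <- s) kern D w z).
  by apply: emeasurable_sum => w; exact: measurable_kern1.
have sk z : K z -> 0 <= \sum_(w <- s) kern D w z.
  by move=> _; apply: sume_ge0 => w _; exact: kern_ge0.
have [||z Kz hz] := @integral_mass1_attained _ _ _ mu K mK muK h.
- exact: emeasurable_funD.
- by move=> z Kz; rewrite adde_ge0 ?sk ?rk.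
have [s' [s'r s'K s'E]] := IH (z :: s).
exists (rcons s' z); split.
- by rewrite size_rcons s'r.
- by move=> w; rewrite mem_rcons inE => /predU1P[->//|]; exact: s'K.
rewrite cat_rcons; apply: (le_trans s'E) => /=.
move: hz; rewrite {1}/h /h ge0_integralD// ge0_integralZl_EFin//; last 2 first.
- by move=> w _; exact: kern_potential_ge0.
- exact: measurable_kern_potential.
rewrite ge0_integral_sum//; last 2 first.
- by move=> w; exact: measurable_kern1.
- by move=> w x _; exact: kern_ge0.
rewrite -/kern_energy -/(kern_potential _).
rewrite [X in X + discrete_energy s](eq_bigr (kern D ^~ z)); last first.
  by move=> w _; exact: kern_sym.
have -> : (\sum_(w <- s) \int[mu]_(x in K) kern D w x) =
  \sum_(w <- s) kern_potential w by [].
have S0 : 0 <= \sum_(w <- s) kern_potential w.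
  by apply: sume_ge0 => w _; exact: kern_potential_ge0.
rewrite big_cons.
move: (\sum_(w <- s) kern_potential w) S0
  (\sum_(w <- s) kern D w z) => S S0 k hz.
rewrite ge0_muleDr ?kern_potential_ge0// binS bin1 natrD EFinD.
rewrite ge0_muleDl ?lee_fin// -natr1 EFinD ge0_muleDl ?lee_fin// mul1e.
rewrite [X in X + _ <= _]addeACA -addeA (le_trans (leeD2r _ hz))//.
rewrite addeACA (addeC S) (addeC (_ * kern_energy)).
by rewrite (addeA (discrete_energy s)).
Qed.

Lemma ge0_adde_le_fin (x y : \bar R) (f : R) : 0 <= x -> 0 <= y ->
  x + y <= f%:E -> exists a b, [/\ x = a%:E, y = b%:E & (a + b <= f)%R].
Proof.
case: x => [a| |]//; case: y => [b| |]//.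
by rewrite -EFinD lee_fin; exists a, b.
Qed.

(** ln V(s) = binomial(n, 2) ln D - E(s) when no truncation occurs in the energy
    E(s), and truncating can only increase E(s). *)
Lemma discrete_energy_vandermonde s e : discrete_energy s <= e%:E ->
  (expR ('C(size s, 2)%:R * ln D - e) <= vandermonde (map toC s))%R.
Proof.
have gap_le z s' f : \sum_(w <- s') kern D z w <= f%:E ->
    (expR ((size s')%:R * ln D - f) <= gap (map toC s') (toC z))%R.
  rewrite gapE big_map; elim: s' f => [|w s' IH] f.
    by rewrite !big_nil lee_fin => f0; rewrite mul0r -expR0 ler_expR; lra.
  rewrite !big_cons => /ge0_adde_le_fin[||a [b [ka sb abf]]].
  - exact: kern_ge0.
  - by apply: sume_ge0 => ? _; exact: kern_ge0.
  rewrite (@le_trans _ _ (expR (ln D - a) *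
                          expR ((size s')%:R * ln D - b))%R)//.
    by rewrite -expRD ler_expR/= -natr1; lra.
  by rewrite ler_pM ?expR_ge0// ?kern_le ?IH ?ka ?sb.
elim: s e => [|z s IH] e /=.
  by rewrite lee_fin => e0; rewrite mul0r -expR0 ler_expR; lra.
move=> /ge0_adde_le_fin[||b [a [sb sa abe]]].
- by apply: sume_ge0 => ? _; exact: kern_ge0.
- exact: discrete_energy_ge0.
rewrite (@le_trans _ _ (expR ((size s)%:R * ln D - b) *
                        expR ('C(size s, 2)%:R * ln D - a))%R)//.
  by rewrite -expRD ler_expR/= binS bin1 natrD; lra.
rewrite ler_pM ?expR_ge0//; first by apply: gap_le; rewrite sb.
by apply: IH; rewrite sa.
Qed.

End Greedy.

(** The supremum T of the energies need not be attained, so only exponents L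
    below T are reached. *)
Lemma capacity_transfinite (R : realType) (K : set (R * R)) (T L : R) :
  compact K -> (forall c, (c < T)%R -> exists2 mu, probabilities_on K mu &
     (c%:E <= log_energy K mu)%E) -> L < T ->
  log_transfinite_ge [set x | exists2 z, K z & x = toC z] L.
Proof.
move=> cK hT /hT[mu muK hmu] N.
have mK := compact_measurable_plane cK.
have [C KC] := compact_bounded_plane cK.
pose D := Num.max (2 * C) 1.
have D0 : 0 < D by rewrite lt_max ltr01 orbT.
have KD z w : K z -> K w -> dist z w <= D.
  move=> /KC zC /KC wC; rewrite le_max (le_trans (ler_normcD _ _))//.
  by rewrite normcN; lra.
have [s [sN sK sE]] := @greedy_points R mu K D mK muK N [::].
rewrite cats0 big_nil mule0 add0e /= add0e in sE.
have JL : (kern_energy mu K D <= (ln D - L)%:E)%E.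
  move: hmu; rewrite (log_energy_kern_energy mK muK D0 KD).
  case: (kern_energy _ _ _) (kern_energy_ge0 mu K D) => [r| |]//= _.
  by rewrite -EFinB !lee_fin => h; lra.
exists (map toC s); split.
- by rewrite size_map.
- by move=> x /mapP[z zs ->]; exists z => //; exact: sK.
have := @discrete_energy_vandermonde R D s ('C(N, 2)%:R * (ln D - L)).
rewrite sN => H; apply: (le_trans _ (H _)).
  by rewrite ler_expR; lra.
by rewrite (le_trans sE)// EFinM lee_wpmul2l ?lee_fin.
Qed.

(** * Decay of the minimal area *)

Section Decay.
Variable R : realType.

Lemma capacity_log_transfinite (t : R) (K : set (R * R)) (L : R) : 0 < t ->
  compact K -> capacity K = t%:E -> L < ln t ->
  log_transfinite_ge [set x | exists2 z, K z & x = toC z] L.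
Proof.
move=> t0 cK hcap LT; apply: (capacity_transfinite cK _ LT) => c cT.
have supE :
    ereal_sup [set log_energy K mu | mu in probabilities_on K] = (ln t)%:E.
  by apply: expeR_inj; rewrite -[LHS]/(capacity K) hcap /= lnK.
have : (c%:E < ereal_sup [set log_energy K mu | mu in probabilities_on K])%E.
  by rewrite supE lte_fin.
by move=> /ereal_sup_gt[_ [mu Kmu <-]] /ltW ?; exists mu.
Qed.

Lemma min_area_le (t : R) (K : set (R * R)) (n : nat) : 1 < t ->
  compact K -> capacity K = t%:E ->
  (min_area n.+2 K <=
    (n.+2%:R * (2 * (n.+2%:R / (expR (n.+1%:R * ln t) / 2))) ^+ 2)%:E)%E.
Proof.
move=> t1 cK hcap.
have t0 : 0 < t by lra.
have [C KC] := compact_bounded_plane cK.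
have AC x : (exists2 z, K z & x = toC z) -> normc x <= C by move=> [z /KC ? ->].
have [s [sn sA us sgap]] := fekete_separation n (ln_gt0 t1)
  (fun L => capacity_log_transfinite t0 cK hcap) AC.
pose s0 : seq (R * R) := [seq (complex.Re x, complex.Im x) | x <- s].
have s0E : map toC s0 = s.
  by rewrite /s0 -map_comp -[RHS]map_id; apply: eq_map => -[a b].
have us0 : uniq s0 by rewrite (@map_uniq _ _ toC)// s0E.
have sz : size s0 = n.+2 by rewrite size_map.
apply: (@le_trans _ _ (area (lemniscate (rootsP (map toC s0))))).
  apply: ereal_inf_lbound; exists (rootsP (map toC s0)) => //; rewrite -sz.
  exists (in_tuple s0); split.
    move=> j; have /mapP[x /sA[z Kz ->] ->] := mem_tnth j (in_tuple s0).
    by case: z Kz.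
  by rewrite /rootsP big_map big_tnth.
rewrite -sz; apply: area_lemniscate_le => //.
  by rewrite divr_gt0 ?expR_gt0.
by rewrite s0E => x /sgap; lra.
Qed.

Lemma ln_eventually_le (c e : R) : 0 < e ->
  exists N, forall n, (N <= n)%N -> c + 3 * ln n%:R <= e * n%:R.
Proof.
move=> e0; pose Y := (`|c| + 6) / e + 1.
have Y1 : 1 <= Y by rewrite lerDr divr_ge0 ?(ltW e0)// addr_ge0.
exists (Num.truncn (Y ^+ 2)).+1 => n nN.
have nY : Y ^+ 2 <= n%:R.
  by rewrite (le_trans (ltW (truncnS_gt _)))// ler_nat.
pose y := Num.sqrt n%:R : R.
have yY : Y <= y.
  by rewrite -[Y]ger0_norm -?sqrtr_sqr ?ler_wsqrtr//; lra.
have ny : n%:R = y ^+ 2 by rewrite sqr_sqrtr.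
rewrite ny lnXn; last by lra.
have ly : ln y < y by apply: ln_sublinear; lra.
have := ler_norm c => cc.
have eY : (`|c| + 6) < y * e by rewrite -ltr_pdivrMr//; rewrite /Y in yY; lra.
have c0 := normr_ge0 c.
(* c + 3 ln (y^2) <= |c| + 6 y <= (|c| + 6) y <= e y^2, as y >= 1 *)
rewrite -(mulr_natl (ln _)) expr2 mulrCA; nra.
Qed.

(** In degree n the bound of [min_area_le] is 16 n^3 t^2 t^(-2n), whose
    polynomial factor is eventually at most exp(e n). *)
Lemma min_area_eventually_le (t e : R) (K : set (R * R)) : 1 < t ->
  compact K -> capacity K = t%:E -> 0 < e ->
  exists N, forall n, (N <= n)%N ->
    (0 < n)%N /\ (min_area n K <= (expR (n%:R * (e - 2 * ln t)))%:E)%E.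
Proof.
move=> t1 cK hcap e0.
have [N HN] := ln_eventually_le (ln 16 + 2 * ln t) e0.
exists (maxn N 2) => n; rewrite geq_max => /andP[Nn n2].
split; first exact: ltnW.
case: n n2 Nn => [|[|n]]// _ Nn.
apply: (le_trans (min_area_le n t1 cK hcap)); rewrite lee_fin.
have n0 : 0 < n.+2%:R :> R by rewrite ltr0n.
have := HN _ Nn; set m : R := n.+2%:R.
have -> : n.+1%:R = m - 1 :> R by rewrite /m -[in RHS]natr1 addrK.
rewrite -/m in n0; move: m n0 => m m0 h.
have p0 : 0 < m * (2 * (m / (expR ((m - 1) * ln t) / 2))) ^+ 2.
  by rewrite mulr_gt0// exprn_gt0// mulr_gt0// divr_gt0// divr_gt0// expR_gt0.
rewrite -ler_ln ?posrE ?expR_gt0// expRK.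
have -> : m * (2 * (m / (expR ((m - 1) * ln t) / 2))) ^+ 2 =
    16 * m ^+ 3 / expR ((m - 1) * ln t) ^+ 2.
  by field; rewrite gt_eqF// expR_gt0.
rewrite ln_div ?posrE ?mulr_gt0 ?exprn_gt0 ?expR_gt0// lnM ?posrE ?exprn_gt0//.
rewrite !lnXn ?expR_gt0// expRK -(mulr_natl (ln m)) -(mulr_natl (_ * ln t)).
lra.
Qed.

Lemma min_area_ge0 n (K : set (R * R)) : (0 <= min_area n K)%E.
Proof. by apply: le_ereal_inf_tmp => _ [p _ <-]; exact: measure_ge0. Qed.

End Decay.

Theorem theorem3p1 (R : realType) (t : R) (ht : 1 < t) (K : set (R * R))
    (hK : compact K) (hcap : capacity K = t%:E) :
  (limn_esup (fun n : nat => lne (min_area n K) * (n%:R^-1)%:E)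
     <= (- 2 * ln t)%:E)%E
  /\ inf_min_area K = 0%E.
Proof.
split.
  apply/lee_addgt0Pr => e e0.
  have [N HN] := min_area_eventually_le ht hK hcap e0.
  apply: (@le_trans _ _ (ereal_sup
      [set lne (min_area n K) * (n%:R^-1)%:E | n in [set n | (N <= n)%N]]%E)).
    by apply: ereal_inf_lbound; exists [set n | (N <= n)%N] => //; exists N.
  apply: ge_ereal_sup => _ [n /= /HN[n0 hn] <-].
  have nR : 0 < n%:R :> R by rewrite ltr0n.
  rewrite lee_pdivrMr// -EFinD -EFinM.
  move: hn (min_area_ge0 n K); case: (min_area n K) => [r| |]//= + _.
  rewrite lee_fin; case: ifPn => [_ _|]; first exact: leNye.
  rewrite -ltNge => r0 h; rewrite lee_fin -ler_expR lnK//.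
  by rewrite (le_trans h)// ler_expR; lra.
apply/le_anti/andP; split; last first.
  by apply: le_ereal_inf_tmp => _ [n _ <-]; exact: min_area_ge0.
apply/lee_addgt0Pr => e e0; rewrite add0e.
have lt0 := ln_gt0 ht.
have [N HN] := min_area_eventually_le ht hK hcap lt0.
pose n := maxn N (Num.truncn (- ln e / ln t)).+1.
have [n0 hn] := HN n (leq_maxl _ _).
apply: (@le_trans _ _ (min_area n K)).
  by apply: ereal_inf_lbound; exists n.
apply: (le_trans hn); rewrite lee_fin -[leRHS]lnK// ler_expR.
have : - ln e / ln t < n%:R.
  by rewrite (lt_le_trans (truncnS_gt _))// ler_nat leq_maxr.
by rewrite ltr_pdivrMr//; lra.
Qed.
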